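(* Let $T\subset\mathbb{R}^d$ be compact, $X=(X(t),t\in T)$ a real-valued centered Gaussian random field with continuous sample paths and covariance $R_X(s,t)$, and $\xi:[0,1]\to T$ continuous. Assume the set of $H\in\mathcal{L}$ with $E[X(\xi(v))H]\ge1$ for all $0\le v\le1$ is nonempty, let $C_X(\xi)=\inf\{EH^2: H\in\mathcal{L},\ E[X(\xi(v))H]\ge1\ \forall v\in[0,1]\}$, and let $H_\xi$ be the unique element of this feasible set attaining the infimum. Let $\mathcal{W}_\xi$ be the set of $\mu\in M_1^+([0,1])$ minimizing $\int_0^1\int_0^1R_X(\xi(u),\xi(v))\mu(du)\mu(dv)$. (i) For every $\mu\in\mathcal{W}_\xi$, $H_\xi=C_X(\xi)\int_0^1X(\xi(v))\,\mu(dv)$ with probability 1. (ii) A probability measure $\mu\in M_1^+([0,1])$ belongs to $\mathcal{W}_\xi$ if and only if $$\min_{0\le v\le1}\int_0^1R_X(\xi(u),\xi(v))\,\mu(du)=\int_0^1\!\!\int_0^1R_X(\xi(u_1),\xi(u_2))\,\mu(du_1)\mu(du_2)>0.$$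
   Context: $\mathcal{L}$ is the closure in $L^2(P)$ of finite linear combinations of values $X(t)$, $t\in T$. $M_1^+([0,1])$ denotes Borel probability measures on $[0,1]$. (Under the nonemptiness assumption, the minimization problem defining $C_X(\xi)$ has a unique minimizer, denoted $H_\xi$.) *)

(* Defs.v *)
From HB Require Import structures.
From mathcomp Require Import all_boot all_order all_algebra.
From mathcomp Require Import all_classical all_reals all_analysis.
Set Implicit Arguments.
Unset Strict Implicit.
Unset Printing Implicit Defensive.
Import Order.TTheory GRing.Theory Num.Theory.
Import numFieldNormedType.Exports.
Local Open Scope classical_set_scope.
Local Open Scope ring_scope.

Section Defs.
Context {R : realType} {d : nat} {dO : measure_display} {Omega : measurableType dO}.
Variable P : probability Omega R.

Definition centered_gaussian (Y : Omega -> R) : Prop :=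
  measurable_fun setT Y /\
  ({ae P, forall w, Y w = 0} \/
   exists s : R, 0 < s /\
     forall B : set R, measurable B -> P (Y @^-1` B) = normal_prob 0 s B).

Definition centered_gaussian_field (T : set 'rV[R]_d)
    (X : 'rV[R]_d -> Omega -> R) : Prop :=
  (forall t, T t -> measurable_fun setT (X t)) /\
  forall (n : nat) (a : 'I_n -> R) (t : 'I_n -> 'rV[R]_d),
    (forall i, T (t i)) ->
    centered_gaussian (fun w => \sum_(i < n) a i * X (t i) w).

(* covariance R_X(s,t) = E[X(s) X(t)] (the field is centered) *)
Definition covX (X : 'rV[R]_d -> Omega -> R) (s t : 'rV[R]_d) : R :=
  fine ('E_P[fun w => X s w * X t w]).

Definition secmom (H : Omega -> R) : \bar R := 'E_P[fun w => H w ^+ 2].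

Definition lincomb (T : set 'rV[R]_d) (X : 'rV[R]_d -> Omega -> R)
    (G : Omega -> R) : Prop :=
  exists (n : nat) (a : 'I_n -> R) (t : 'I_n -> 'rV[R]_d),
    (forall i, T (t i)) /\ G = (fun w => \sum_(i < n) a i * X (t i) w).

Definition inL (T : set 'rV[R]_d) (X : 'rV[R]_d -> Omega -> R)
    (H : Omega -> R) : Prop :=
  measurable_fun setT H /\ (secmom H < +oo)%E /\
  exists G : nat -> Omega -> R, (forall n, lincomb T X (G n)) /\
    (fun n => secmom (fun w => G n w - H w)) @ \oo --> 0%E.

Definition feasible (T : set 'rV[R]_d) (X : 'rV[R]_d -> Omega -> R)
    (xi : R -> 'rV[R]_d) (H : Omega -> R) : Prop :=
  inL T X H /\
  forall v, `[0%R, 1%R]%classic v -> (1 <= 'E_P[fun w => (X (xi v) w * H w)%R])%E.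

Definition CX (T : set 'rV[R]_d) (X : 'rV[R]_d -> Omega -> R)
    (xi : R -> 'rV[R]_d) : \bar R :=
  ereal_inf [set secmom H | H in feasible T X xi].

Definition covpot (X : 'rV[R]_d -> Omega -> R) (xi : R -> 'rV[R]_d)
    (mu : probability R R) (v : R) : \bar R :=
  (\int[mu]_(u in `[0%R, 1%R]%classic) (covX X (xi u) (xi v))%:E)%E.

Definition energy (X : 'rV[R]_d -> Omega -> R) (xi : R -> 'rV[R]_d)
    (mu : probability R R) : \bar R :=
  (\int[mu]_(v in `[0%R, 1%R]%classic) covpot X xi mu v)%E.

Definition prob01 (mu : probability R R) : Prop := mu `[0%R, 1%R]%classic = 1%E.

Definition inW (X : 'rV[R]_d -> Omega -> R) (xi : R -> 'rV[R]_d)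
    (mu : probability R R) : Prop :=
  prob01 mu /\
  forall nu : probability R R, prob01 nu -> (energy X xi mu <= energy X xi nu)%E.

End Defs.

(* Main.v *)
(** Write x_v = X(xi(v)), and let Y_mu be the integral of x_v against mu.  Then
   Y_mu lies in L (it is an L^2-limit of Riemann sums), E[Y_mu x_v] is the
   potential of mu at v, and E[Y_mu^2] is the energy of mu.

   If H is feasible then E[Y_mu H] >= 1, so by Cauchy-Schwarz
   E[H^2] E[Y_mu^2] >= 1; in particular every energy is positive.  If mu
   minimizes the energy, perturbing mu towards the Dirac mass at v gives
   E[Y_mu x_v] >= E[Y_mu^2] =: e for every v.  Hence Y_mu / e is feasible with
   second moment 1 / e, which equals C_X by the previous bound, and any other
   optimal H satisfies E[(H - Y_mu / e)^2] <= 0.  Conversely, if the potential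
   of mu is everywhere at least e, integrating it against nu gives
   E[Y_nu Y_mu] >= e, and E[(Y_nu - Y_mu)^2] >= 0 shows E[Y_nu^2] >= e.

   Gaussianity enters only through finite second moments and the fact that
   centered Gaussian variables converging pointwise to 0 converge in L^2. *)
Require Import Defs.
From HB Require Import structures.
From mathcomp Require Import all_boot all_order all_algebra.
From mathcomp Require Import all_classical all_reals all_analysis.
From mathcomp Require Import measurable_realfun ring lra.
Import Order.TTheory GRing.Theory Num.Def Num.Theory.
Import numFieldNormedType.Exports.
Set Implicit Arguments.
Unset Strict Implicit.
Unset Printing Implicit Defensive.
Local Open Scope classical_set_scope.
Local Open Scope ring_scope.

(** * Centered Gaussian variables *)

Section density.
Local Open Scope ereal_scope.
Context d (T : measurableType d) (R : realType).
Variables (mu nu : {measure set T -> \bar R}) (g : T -> R).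
Hypotheses (mg : measurable_fun setT g) (g0 : forall x, (0 <= g x)%R).
Hypothesis nuE : forall A, measurable A -> nu A = \int[mu]_(x in A) (g x)%:E.

Import HBNNSimple.

Let integral_density_nnsfun (h : {nnsfun T >-> R}) :
  \int[nu]_x (h x)%:E = \int[mu]_x ((h x)%:E * (g x)%:E).
Proof.
rewrite integralT_nnsfun sintegralE.
under [RHS]eq_integral => x _.
  rewrite fimfunE -fsumEFin// ge0_mule_fsuml; last first.
    by move=> r; exact: nnfun_muleindic_ge0.
  over.
rewrite ge0_integral_fsum//; last 2 first.
- move=> r; apply: emeasurable_funM; last exact/measurable_EFinP.
  exact/measurable_EFinP/measurable_funM.
- by move=> r x _; rewrite mule_ge0 ?nnfun_muleindic_ge0 ?lee_fin.
apply: eq_fsbigr => r rh.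
under eq_integral => x _ do rewrite EFinM -muleA.
rewrite ge0_integralZl//; last 3 first.
- apply: emeasurable_funM; exact/measurable_EFinP.
- by move=> x _; rewrite mule_ge0 ?lee_fin.
- by move: rh; rewrite inE => -[x _ <-]; rewrite lee_fin.
congr (_ * _); rewrite nuE// [LHS]integral_mkcond.
apply: eq_integral => x _; rewrite patchE indicE.
by case: ifP => _; rewrite ?mul1e ?mul0e.
Qed.

(** For simple functions this is [nuE] and linearity. Along [nnsfun_approx] both sides pass to the
    limit by monotone convergence, the right one because [g] is nonnegative. *)
Lemma ge0_integral_density (f : T -> \bar R) : measurable_fun setT f ->
  (forall x, 0 <= f x) -> \int[nu]_x f x = \int[mu]_x (f x * (g x)%:E).
Proof.
move=> mf f0; pose h := nnsfun_approx measurableT mf.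
have hf x : EFin \o h^~ x @ \oo --> f x by apply: cvg_nnsfun_approx.
have ndh x : {homo (fun n => (h n x)%:E) : m n / (m <= n)%N >-> m <= n}.
  by move=> m n mn; rewrite lee_fin; exact/lefP/nd_nnsfun_approx.
transitivity (limn (fun n => \int[nu]_x (h n x)%:E)).
  rewrite -monotone_convergence//.
  - by apply: eq_integral => x _; apply/esym/cvg_lim => //; exact: hf.
  - by move=> n; exact/measurable_EFinP.
  - by move=> n x _; rewrite lee_fin.
under eq_fun do rewrite integral_density_nnsfun.
rewrite -monotone_convergence//.
- apply: eq_integral => x _; apply/cvg_lim => //.
  by apply: cvgeZr => //; exact: hf.
- by move=> n; apply: emeasurable_funM; exact/measurable_EFinP.
- by move=> n x _; rewrite mule_ge0 ?lee_fin.
- by move=> x _ m n mn; rewrite lee_wpmul2r ?lee_fin//; exact: ndh.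
Qed.

End density.

(** * Second moments of centered Gaussian variables *)

Section gaussian.
Context {R : realType}.

(* Absorbing the factor [x ^+ 2] by doubling the standard deviation bounds the
   second moment without computing it. *)
Lemma normal_pdf_sqr_le (s x : R) : 0 < s ->
  x ^+ 2 * normal_pdf 0 s x <= 8 * s ^+ 2 * normal_pdf 0 (2 * s) x.
Proof.
move=> s0; have s20 : 2 * s != 0 by rewrite gt_eqF// mulr_gt0.
rewrite !normal_pdfE// ?gt_eqF// /normal_fun !subr0.
have -> : normal_peak s = 2 * normal_peak (2 * s).
  rewrite /normal_peak.
  have -> : (2 * s) ^+ 2 * pi *+ 2 = 2 ^+ 2 * (s ^+ 2 * pi *+ 2) by ring.
  by rewrite sqrtrM ?sqr_ge0// sqrtr_sqr ger0_norm// invfM mulrA divff ?mul1r.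
have p0 : 0 < normal_peak (2 * s) by exact: normal_peak_gt0.
(* The exponent for [s] is the one for [2 * s] minus [c], since 1/2 - 1/8 = 3/8. The factor
   [expR (- c)] left over absorbs [x ^+ 2], a multiple of [s ^+ 2 * c], through [c <= expR c]. *)
have -> : - x ^+ 2 / (s ^+ 2 *+ 2) =
    - x ^+ 2 / ((2 * s) ^+ 2 *+ 2) - 3 * x ^+ 2 / (8 * s ^+ 2).
  by field; rewrite gt_eqF.
set b := - x ^+ 2 / _; set c := 3 * x ^+ 2 / _.
rewrite expRD expRN.
have c0 : 0 <= c by rewrite /c; apply: divr_ge0; apply: mulr_ge0;
  rewrite ?ler0n ?sqr_ge0.
have xc : x ^+ 2 = 8 / 3 * s ^+ 2 * c by rewrite /c; field; rewrite gt_eqF.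
have h : x ^+ 2 * (expR c)^-1 <= 4 * s ^+ 2.
  rewrite ler_pdivrMr ?expR_gt0//.
  apply: (@le_trans _ _ (4 * s ^+ 2 * c)).
    have := mulr_ge0 (sqr_ge0 s) c0; lra.
  apply: ler_wpM2l; first by apply: mulr_ge0 => //; exact: sqr_ge0.
  by have := expR_ge1Dx c; lra.
rewrite [leLHS](_ : _ =
  (x ^+ 2 * (expR c)^-1) * (2 * normal_peak (2 * s) * expR b)); last by ring.
rewrite [leRHS](_ : _ =
  (4 * s ^+ 2) * (2 * normal_peak (2 * s) * expR b)); last by ring.
apply: ler_wpM2r => //; apply: mulr_ge0; last exact: expR_ge0.
by rewrite mulr_ge0// ltW.
Qed.

(** Formulated for any [nu] agreeing with the normal law on measurable sets, so that it applies to
    the distribution of a random variable. *)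
Lemma normal_prob_sqr_le (s : R) (nu : {measure set (measurableTypeR R) -> \bar R}) :
  0 < s ->
  (forall A, measurable A -> nu A = normal_prob 0 s A) ->
  (\int[nu]_x (x ^+ 2)%:E <= (8 * s ^+ 2)%:E)%E.
Proof.
move=> s0 nuE.
rewrite (@ge0_integral_density _ _ _ lebesgue_measure _ (normal_pdf 0 s))//=.
- apply: (@le_trans _ _
    (\int[lebesgue_measure]_x ((8 * s ^+ 2)%:E * (normal_pdf 0 (2 * s) x)%:E))%E).
    apply: ge0_le_integral => //=.
    + by move=> x _; rewrite mule_ge0 ?lee_fin ?sqr_ge0 ?normal_pdf_ge0.
    + apply: emeasurable_funM; apply/measurable_EFinP.
        exact: measurable_funX.
      exact: measurable_normal_pdf.
    + apply: emeasurable_funM => //; apply/measurable_EFinP.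
      exact: measurable_normal_pdf.
    + by move=> x _; rewrite -!EFinM lee_fin normal_pdf_sqr_le.
  rewrite ge0_integralZl//=.
  + by rewrite integral_normal_pdf mule1.
  + by apply/measurable_EFinP; exact: measurable_normal_pdf.
  + by move=> x _; rewrite lee_fin normal_pdf_ge0.
  + by rewrite lee_fin mulr_ge0 ?sqr_ge0 ?ler0n.
- exact: measurable_normal_pdf.
- by move=> x; exact: normal_pdf_ge0.
- by apply/measurable_EFinP; exact: measurable_funX.
- by move=> x; rewrite lee_fin sqr_ge0.
Qed.

(** Anticoncentration: the density never exceeds its peak. *)
Lemma normal_prob_itv_le (s e : R) : 0 < s -> 0 < e ->
  (normal_prob 0 s `[- e, e]%classic%R <= (2 * e * normal_peak s)%:E)%E.
Proof.
move=> s0 e0; rewrite /normal_prob.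
apply: (@le_trans _ _
    (\int[lebesgue_measure]_(x in `[- e, e]%classic%R) (normal_peak s)%:E)%E).
  apply: ge0_le_integral => //=.
  - by move=> x _; rewrite lee_fin normal_pdf_ge0.
  - by apply/measurable_EFinP/measurable_funTS; exact: measurable_normal_pdf.
  - by move=> x _; rewrite lee_fin normal_pdf_ub// gt_eqF.
rewrite integral_cst//= lebesgue_measure_itv/= lte_fin ifT; last by lra.
by rewrite -EFinD -EFinM lee_fin le_eqVlt; apply/orP; left; apply/eqP; ring.
Qed.

Context d (T : measurableType d) (P : probability T R).

Lemma secmom_ae_eq0 (Y : T -> R) : measurable_fun setT Y ->
  {ae P, forall w, Y w = 0} -> secmom P Y = 0%E.
Proof.
move=> mY Y0; rewrite /secmom unlock (@ae_eq_integral _ _ _ _ _ (cst 0%E))//=.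
- by rewrite integral0.
- by apply/measurable_EFinP; exact: measurable_funX.
- by apply: filterS Y0 => w Yw _; rewrite Yw expr0n.
Qed.

Lemma secmom_normal_le (Y : T -> R) (s : R) : measurable_fun setT Y -> 0 < s ->
  (forall B : set R, measurable B -> P (Y @^-1` B) = normal_prob 0 s B) ->
  (secmom P Y <= (8 * s ^+ 2)%:E)%E.
Proof.
move=> mY s0 hP; rewrite /secmom unlock.
pose mYp := isMeasurableFun.Build _ _ T (measurableTypeR R) Y mY.
pose Y' : {RV P >-> measurableTypeR R} := HB.pack Y mYp.
have := @normal_prob_sqr_le s (distribution P Y') s0 (fun A mA => hP A mA).
rewrite ge0_integral_distribution//=.
- by apply/measurable_EFinP; exact: measurable_funX.
- by move=> x; rewrite lee_fin sqr_ge0.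
Qed.

Lemma centered_gaussian_secmom_lty (Y : T -> R) :
  centered_gaussian P Y -> (secmom P Y < +oo)%E.
Proof.
move=> [mY [Y0|[s [s0 hP]]]]; first by rewrite secmom_ae_eq0.
by rewrite (le_lt_trans (secmom_normal_le mY s0 hP))// ltry.
Qed.

(** Half of the mass within distance [e] of 0 forces a small deviation: anticoncentration gives
    [sqrt (2 pi s^2) <= 4 e], hence [s^2 <= 4 e^2] by [pi >= 2], and the second moment is at most
    [8 s^2]. *)
Lemma centered_gaussian_secmom_le (Y : T -> R) (e : R) :
  centered_gaussian P Y -> 0 < e ->
  (2^-1%:E <= P [set w | (`|Y w| <= e)%R])%E ->
  (secmom P Y <= (32 * e ^+ 2)%:E)%E.
Proof.
move=> [mY hY] e0 Ye.
case: hY => [Y0|[s [s0 hP]]].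
  by rewrite secmom_ae_eq0// lee_fin mulr_ge0 ?sqr_ge0 ?ler0n.
have peak : 2^-1 <= 2 * e * normal_peak s.
  rewrite -lee_fin; apply: le_trans (normal_prob_itv_le s0 e0).
  rewrite -hP//; apply: (le_trans Ye).
  rewrite [X in P X](_ : _ = Y @^-1` `[- e, e]%classic)//.
  by apply/funext => w /=; rewrite in_itv/= ler_norml.
have se : s ^+ 2 <= 4 * e ^+ 2.
  have q0 : 0 < s ^+ 2 * pi *+ 2.
    by rewrite mulrn_wgt0// mulr_gt0 ?pi_gt0 ?exprn_gt0.
  have sq : Num.sqrt (s ^+ 2 * pi *+ 2) <= 4 * e.
    by move: peak; rewrite /normal_peak ler_pdivlMr ?sqrtr_gt0//; lra.
  have : Num.sqrt (s ^+ 2 * pi *+ 2) ^+ 2 <= (4 * e) ^+ 2.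
    by apply: lerXn2r => //; rewrite nnegrE ?sqrtr_ge0//; lra.
  rewrite sqr_sqrtr; last exact: ltW.
  have := ler_wpM2l (sqr_ge0 s) (@pi_ge2 R).
  lra.
apply: (le_trans (secmom_normal_le mY s0 hP)).
by rewrite lee_fin; lra.
Qed.

(** Pointwise convergence implies convergence in probability, so for each [e] eventually half of the
    mass of [Z n] lies in [[- e, e]], and the previous bound controls the second moment. *)
Lemma cvg_secmom_centered_gaussian (Z : nat -> T -> R) :
  (forall n, centered_gaussian P (Z n)) ->
  (forall w, Z n w @[n --> \oo] --> (0 : R)) ->
  secmom P (Z n) @[n --> \oo] --> 0%E.
Proof.
move=> gZ Z0.
have mA n (e : R) : measurable [set w | (e < `|Z n w|)%R].
  have [mZ _] := gZ n.
  rewrite [X in measurable X](_ : _ = (normr \o Z n) @^-1` `]e, +oo[%classic).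
    by rewrite -[X in measurable X]setTI; exact: measurableT_comp.
  by apply/funext => w /=; rewrite in_itv/= andbT.
have A0 (e : R) : 0 < e -> P [set w | (e < `|Z n w|)%R] @[n --> \oo] --> 0%E.
  move=> e0.
  rewrite [X in X @ _ --> _](_ : _ = fun n =>
      (\int[P]_w (\1_[set w | (e < `|Z n w|)%R] w)%:E)%E); last first.
    by apply/funext => n; rewrite integral_indic// setIT.
  rewrite -(integral0 P setT).
  apply: (@dominated_cvg _ _ _ P setT _ _ _ (cst 1%E)) => //=.
  - by move=> n; apply/measurable_EFinP; exact: measurable_indic.
  - move=> w _; apply: cvg_near_cst.
    have /cvgr0Pnorm_le : Z n w @[n --> \oo] --> (0 : R) by exact: Z0.
    move=> /(_ _ e0); apply: filterS => n /= Zn.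
    by rewrite indicE memNset//= ltNge Zn.
  - exact: finite_measure_integrable_cst.
  - by move=> n w _; rewrite lee_fin indicE; case: (_ \in _);
      rewrite ?normr1 ?normr0.
have half (e : R) : 0 < e ->
    \forall n \near \oo, (2^-1%:E <= P [set w | (`|Z n w| <= e)%R])%E.
  have h2 : (0 : R) < 2^-1 by rewrite invr_gt0.
  move=> e0; have /fine_cvgP[finA /cvgr0Pnorm_le/(_ _ h2)] := A0 _ e0.
  apply: filterS2 finA => n /= finA.
  rewrite ger0_norm ?fine_ge0// -lee_fin fineK// => PA.
  rewrite [X in P X](_ : _ = ~` [set w | (e < `|Z n w|)%R]); last first.
    by apply/seteqP; split => w /=; rewrite leNgt => /negP.
  rewrite probability_setC//.
  rewrite leeBrDr// (le_trans (leeD2l _ PA))// -EFinD lee_fin.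
  by have := splitr (1 : R); rewrite !div1r => <-.
have sle (e : R) : 0 < e ->
    \forall n \near \oo, (secmom P (Z n) <= (32 * e ^+ 2)%:E)%E.
  by move=> e0; apply: filterS (half _ e0) => n; exact: centered_gaussian_secmom_le.
have s0 n : (0 <= secmom P (Z n))%E.
  by rewrite /secmom unlock integral_ge0// => w _; rewrite lee_fin sqr_ge0.
apply/fine_cvgP; split.
  apply: filterS (sle 1 ltr01) => n sn.
  by rewrite ge0_fin_numE// (le_lt_trans sn)// ltry.
apply/cvgr0Pnorm_le => e e0.
(* The radius whose bound [32 * r ^+ 2] is exactly [e]. *)
have se0 : 0 < Num.sqrt (e / 32) by rewrite sqrtr_gt0 divr_gt0.
apply: filterS (sle _ se0) => n sn /=.
rewrite ger0_norm ?fine_ge0// -lee_fin fineK; last first.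
  by rewrite ge0_fin_numE// (le_lt_trans sn)// ltry.
apply: (le_trans sn); rewrite lee_fin sqr_sqrtr; last by rewrite divr_ge0// ltW.
by rewrite mulrC divfK.
Qed.

End gaussian.

(** * Square-integrable functions *)

Section square_integrable.
Context {d} {T : measurableType d} {R : realType} (P : probability T R).
Implicit Types f g h : T -> R.

Definition sqint f :=
  measurable_fun setT f /\ P.-integrable setT (fun w => (f w ^+ 2)%:E).

(** The L^2 inner product, on functions rather than classes. As a [fine] value it represents the
    expectation only when the product is integrable, hence the [sqint] hypotheses below. *)
Definition ip f g : R := \int[P]_w (f w * g w).

Lemma sqintP f : measurable_fun setT f -> (secmom P f < +oo)%E -> sqint f.
Proof.
rewrite /secmom unlock => mf foo; split => //; apply/integrableP; split.
  by apply/measurable_EFinP; exact: measurable_funX.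
by under eq_integral do rewrite gee0_abs ?lee_fin ?sqr_ge0//.
Qed.

Lemma sqint_mul f g : sqint f -> sqint g ->
  P.-integrable setT (fun w => (f w * g w)%:E).
Proof.
move=> [mf If] [mg Ig].
apply: (le_integrable measurableT _ _ (integrableD measurableT If Ig)).
  by apply/measurable_EFinP; exact: measurable_funM.
move=> w _ /=; rewrite lee_fin normrM (@ger0_norm _ (_ + _)) ?addr_ge0 ?sqr_ge0//.
have nK h : h w ^+ 2 = `|h w| ^+ 2 by rewrite real_normK ?num_real.
rewrite (nK f) (nK g); move: `|f w| `|g w| => a b.
by have := sqr_ge0 (a - b); have := sqr_ge0 a; have := sqr_ge0 b; nra.
Qed.

Lemma sqint_int f : sqint f -> P.-integrable setT (fun w => (f w)%:E).
Proof.
move=> [mf If].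
have I1 : P.-integrable setT (cst 1%E) by exact: finite_measure_integrable_cst.
apply: (le_integrable measurableT _ _ (integrableD measurableT I1 If)).
  exact/measurable_EFinP.
move=> w _ /=; rewrite lee_fin (@ger0_norm _ (1 + _)) ?addr_ge0 ?sqr_ge0//.
have -> : f w ^+ 2 = `|f w| ^+ 2 by rewrite real_normK ?num_real.
by move: `|f w| => a; have := sqr_ge0 (a - 1); have := sqr_ge0 a; nra.
Qed.

Lemma sqint_bounded f : measurable_fun setT f ->
  (exists B, forall w, `|f w| <= B) -> sqint f.
Proof.
move=> mf [B fB]; split => //.
have IB : P.-integrable setT (cst (B ^+ 2)%:E).
  exact: (finite_measure_integrable_cst _ (B ^+ 2)).
apply: (le_integrable measurableT _ _ IB).
  by apply/measurable_EFinP; exact: measurable_funX.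
move=> w _ /=; rewrite lee_fin !normrX lerXn2r ?nnegrE//.
by rewrite (le_trans (fB w))// ler_norm.
Qed.

Lemma sqintDZ a b f g : sqint f -> sqint g ->
  sqint (fun w => a * f w + b * g w).
Proof.
move=> sf sg; have [mf If] := sf; have [mg Ig] := sg; split.
  by apply: measurable_funD; apply: measurable_funM.
rewrite (_ : (fun w => _) = (fun w => (a ^+ 2)%:E * (f w ^+ 2)%:E +
  ((2 * a * b)%:E * (f w * g w)%:E + (b ^+ 2)%:E * (g w ^+ 2)%:E))%E).
  apply: integrableD => //; first exact: integrableZl.
  apply: integrableD => //; apply: integrableZl => //.
  exact: sqint_mul.
by apply/funext => w; rewrite -!EFinM -!EFinD; congr EFin; ring.
Qed.

Lemma sqint_cst c : sqint (cst c).
Proof. by split => //; exact: (finite_measure_integrable_cst _ (c ^+ 2)). Qed.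

Lemma sqintB f g : sqint f -> sqint g -> sqint (fun w => f w - g w).
Proof.
move=> sf sg; have := sqintDZ 1 (-1) sf sg.
by congr sqint; apply/funext => w; rewrite mul1r mulN1r.
Qed.

Lemma sqintZ a f : sqint f -> sqint (fun w => a * f w).
Proof.
move=> sf; have := sqintDZ a 0 sf sf.
by congr sqint; apply/funext => w; rewrite mul0r addr0.
Qed.

Lemma ipE f g : sqint f -> sqint g ->
  (\int[P]_w (f w * g w)%:E)%E = (ip f g)%:E.
Proof.
move=> sf sg; rewrite /ip /Rintegral fineK//.
by apply: integrable_fin_num => //; exact: sqint_mul.
Qed.

Lemma secmomE f : sqint f -> secmom P f = (ip f f)%:E.
Proof.
move=> sf; rewrite -ipE// /secmom unlock.
by under eq_integral do rewrite expr2.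
Qed.

Lemma ipC f g : ip f g = ip g f.
Proof. by apply: eq_Rintegral => w _; rewrite mulrC. Qed.

Lemma ip_ge0 f : 0 <= ip f f.
Proof. by apply: Rintegral_ge0 => w _; rewrite -expr2 sqr_ge0. Qed.

Lemma ipDZl a b f g h : sqint f -> sqint g -> sqint h ->
  ip (fun w => a * f w + b * g w) h = a * ip f h + b * ip g h.
Proof.
move=> sf sg sh; rewrite /ip.
under eq_Rintegral do rewrite mulrDl -!mulrA.
rewrite RintegralD//; last 2 first.
- rewrite (_ : _ \o _ = (fun w => a%:E * (f w * h w)%:E)%E)//.
  by apply: integrableZl => //; exact: sqint_mul.
- rewrite (_ : _ \o _ = (fun w => b%:E * (g w * h w)%:E)%E)//.
  by apply: integrableZl => //; exact: sqint_mul.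
by rewrite !RintegralZl//; exact: sqint_mul.
Qed.

Lemma ip_sqrDZ a b f g : sqint f -> sqint g ->
  ip (fun w => a * f w + b * g w) (fun w => a * f w + b * g w) =
  a ^+ 2 * ip f f + 2 * a * b * ip f g + b ^+ 2 * ip g g.
Proof.
move=> sf sg; have sfg := sqintDZ a b sf sg.
rewrite ipDZl// [ip f _]ipC [ip g _]ipC !ipDZl// [ip g f]ipC; ring.
Qed.

Lemma ip_sqrB f g : sqint f -> sqint g ->
  ip (fun w => f w - g w) (fun w => f w - g w) = ip f f - 2 * ip f g + ip g g.
Proof.
move=> sf sg; rewrite [LHS](_ : _ = ip (fun w => 1 * f w + (-1) * g w)
  (fun w => 1 * f w + (-1) * g w)).
  by rewrite ip_sqrDZ//; ring.
by congr ip; apply/funext => w; rewrite mul1r mulN1r.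
Qed.

Lemma cauchy_schwarz_ip f g : sqint f -> sqint g ->
  ip f g ^+ 2 <= ip f f * ip g g.
Proof.
move=> sf sg.
have key a b : 0 <= a ^+ 2 * ip f f + 2 * a * b * ip f g + b ^+ 2 * ip g g.
  by rewrite -ip_sqrDZ// ip_ge0.
have := ip_ge0 g; rewrite le_eqVlt => /predU1P[g0|g0].
  have [->|fg0] := eqVneq (ip f g) 0; first by rewrite expr0n/= -g0 mulr0.
  have := key 1 (- (ip f f + 1) / (2 * ip f g)); rewrite -g0.
  have -> : 2 * 1 * (- (ip f f + 1) / (2 * ip f g)) * ip f g = - (ip f f + 1).
    by field.
  lra.
(* The residual of projecting [f] on [g], scaled by [ip g g] to avoid a division. *)
have := key (ip g g) (- ip f g).
have -> : ip g g ^+ 2 * ip f f + 2 * ip g g * - ip f g * ip f g +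
   (- ip f g) ^+ 2 * ip g g = ip g g * (ip f f * ip g g - ip f g ^+ 2) by ring.
by rewrite pmulr_rge0// subr_ge0.
Qed.

Lemma ip_eq0_ae f : sqint f -> ip f f = 0 -> {ae P, forall w, f w = 0}.
Proof.
move=> sf f0; have := secmomE sf; rewrite f0 /secmom unlock => h.
have mf2 : measurable_fun setT (fun w => (f w ^+ 2)%:E).
  by apply/measurable_EFinP; apply: measurable_funX; case: sf.
have /(ae_eq_integral_abs P measurableT mf2) : (\int[P]_w `|(f w ^+ 2)%:E| = 0)%E.
  by under eq_integral do rewrite gee0_abs ?lee_fin ?sqr_ge0//.
apply: filterS => w /(_ I)[] /eqP; rewrite sqrf_eq0 => /eqP; exact.
Qed.

End square_integrable.

(** * Discretization of the unit interval and mixtures *)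

Section clamp.
Context {R : realType}.

(* Composing with [clamp] extends paths over [0, 1] to bounded continuous paths
   over the whole line, so that integrals over [0, 1] become integrals over R. *)
Definition clamp (v : R) : R := maxr 0 (minr 1 v).

Lemma clamp01 v : 0 <= clamp v <= 1.
Proof. by rewrite /clamp le_max lexx/= ge_max ler01 ge_min lexx. Qed.

Lemma clamp_id v : 0 <= v <= 1 -> clamp v = v.
Proof. by move=> /andP[v0 v1]; rewrite /clamp min_r// max_r. Qed.

Lemma clampK v : clamp (clamp v) = clamp v.
Proof. exact/clamp_id/clamp01. Qed.

Lemma continuous_clamp : continuous clamp.
Proof.
move=> v; apply: (@continuous_max _ _ (cst 0 : R -> R^o) (cst 1 \min id)).
  exact: cvg_cst.
by apply: (@continuous_min _ _ (cst 1 : R -> R^o) id);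
  [exact: cvg_cst|exact: cvg_id].
Qed.

(** Index of the multiple of [1 / n.+1] to which [clamp v] is rounded down. The index [n.+1] occurs
    when [clamp v = 1], so there are [n.+2] values. *)
Definition grid (n : nat) (v : R) : nat := truncn (clamp v * n.+1%:R).

Lemma grid_lt n v : (grid n v < n.+2)%N.
Proof.
have /andP[v0 v1] := clamp01 v.
rewrite /grid ltnS truncn_le_nat; apply: (le_lt_trans (y := n.+1%:R)).
  by rewrite ler_piMl.
by rewrite ltr_nat.
Qed.

Lemma gridE n v i : (grid n v == i) = (i%:R <= clamp v * n.+1%:R < i.+1%:R).
Proof.
have /andP[v0 v1] := clamp01 v; rewrite /grid truncn_eq//.
by rewrite mulr_ge0.
Qed.

Lemma measurable_grid n i : measurable [set v | grid n v = i].
Proof.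
rewrite [X in measurable X](_ : _ =
    (fun v => clamp v * n.+1%:R) @^-1` `[i%:R, i.+1%:R[%classic).
  rewrite -[X in measurable X]setTI.
  suff : measurable_fun setT (fun v => clamp v * n.+1%:R) by exact.
  apply: measurable_funM => //; apply: continuous_measurable_fun.
  exact: continuous_clamp.
by apply/seteqP; split => v /=; rewrite in_itv/= -gridE => /eqP.
Qed.

Lemma cvg_grid v : (grid n v)%:R / n.+1%:R @[n --> \oo] --> clamp v.
Proof.
apply/cvgrPdist_le => e e0.
have := @cvg_harmonic R; move=> /cvgr0Pnorm_le/(_ _ e0); apply: filterS => n.
rewrite /harmonic/= ger0_norm// => ne; apply: le_trans ne.
have : grid n v == grid n v by []. rewrite gridE => /andP[h1 h2].
rewrite ger0_norm; last by rewrite subr_ge0 ler_pdivrMr.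
rewrite lerBlDr (_ : _ + _ = (grid n v).+1%:R / n.+1%:R).
  by rewrite ler_pdivlMr// ltW.
by rewrite -[(grid n v).+1%:R]natr1 mulrDl mul1r addrC.
Qed.

End clamp.

Section mixture.
Context {d} {T : measurableType d} {R : realType}.

(** Supplies the competitors for the first-order condition of energy minimization. The integral
    formula is proved for nonnegative integrands and then applied to the positive and negative parts
    of [f]. *)
Lemma exists_mixture (t : R) (mu nu : probability T R) : 0 < t < 1 ->
  exists m : probability T R,
    (forall A, m A = (1 - t)%:E * mu A + t%:E * nu A)%E /\
    forall f : T -> R, mu.-integrable setT (EFin \o f) ->
      nu.-integrable setT (EFin \o f) ->
      \int[m]_v f v = (1 - t) * \int[mu]_v f v + t * \int[nu]_v f v.
Proof.
move=> /andP[t0 t1].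
have t1' : 0 <= 1 - t by rewrite subr_ge0 ltW.
pose m : {measure set T -> \bar R} :=
  measure_add (mscale (NngNum t1') mu) (mscale (NngNum (ltW t0)) nu).
have mE A : (m A = (1 - t)%:E * mu A + t%:E * nu A)%E.
  exact: measure_addE.
have m1 : m setT = 1%E by rewrite mE !probability_setT !mule1 -EFinD subrK.
pose mP := Measure_isProbability.Build _ _ _ (Measure.sort m) m1.
pose mp : probability T R := HB.pack (Measure.sort m) mP.
exists mp; split => // f imu inu.
have mf : measurable_fun setT (EFin \o f) by case/integrableP : imu.
have pE g : measurable_fun setT g -> (forall v, 0 <= g v)%E ->
    (\int[mp]_v g v = (1 - t)%:E * \int[mu]_v g v + t%:E * \int[nu]_v g v)%E.
  move=> mg g0.
  have := @ge0_integral_measure_add _ T R (mscale (NngNum t1') mu)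
    (mscale (NngNum (ltW t0)) nu) setT measurableT g (fun v _ => g0 v) mg.
  by rewrite !ge0_integral_mscale.
rewrite /Rintegral integralE.
rewrite pE//; last exact: measurable_funepos.
rewrite pE//; last exact: measurable_funeneg.
rewrite [in RHS]integralE [(\int[nu]_v (f v)%:E)%E]integralE.
have fp (k : probability T R) : k.-integrable setT (EFin \o f) ->
    ((\int[k]_v (EFin \o f)^\+ v \is a fin_num)%E *
     (\int[k]_v (EFin \o f)^\- v \is a fin_num)%E)%type.
  move=> ik; split; apply: integrable_fin_num => //.
  - exact: integrable_funepos.
  - exact: integrable_funeneg.
have [up un] := fp _ imu; have [vp vn] := fp _ inu.
move: up un vp vn => /fineK <- /fineK <- /fineK <- /fineK <-.
rewrite -?EFinM -?EFinD /=; ring.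
Qed.

End mixture.

(** * Averages of Gaussian paths *)

Section partial_integral.
Context {d1 d2} {T1 : measurableType d1} {T2 : measurableType d2} {R : realType}.
Variables (P : probability T1 R) (mu : probability T2 R) (F : T1 * T2 -> R).
Hypothesis mF : measurable_fun setT F.

(** Tonelli handles the positive and negative parts separately, and [fine] is measurable, so
    sections may fail to be integrable. *)
Lemma measurable_partial_Rintegral :
  measurable_fun setT (fun w => \int[mu]_v F (w, v)).
Proof.
have mE : measurable_fun setT (EFin \o F) by exact/measurable_EFinP.
have mp := measurable_funepos mE; have mn := measurable_funeneg mE.
rewrite [X in measurable_fun _ X](_ : _ = fun w =>
    fine (\int[mu]_v (EFin \o F)^\+ (w, v) - \int[mu]_v (EFin \o F)^\- (w, v))%E).
  apply: measurableT_comp => //; apply: emeasurable_funB.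
    exact: (measurable_fun_fubini_tonelli_F (m2 := mu) (EFin \o F)^\+%E).
  exact: (measurable_fun_fubini_tonelli_F (m2 := mu) (EFin \o F)^\-%E).
apply/funext => w; rewrite /Rintegral integralE.
by congr (fine (_ - _)%E); apply: eq_integral => v _; rewrite !unlock.
Qed.

Lemma measurable_partial_sqr :
  measurable_fun setT (fun v => \int[P]_w (F (w, v) ^+ 2)%:E)%E.
Proof.
apply: (measurable_fun_fubini_tonelli_G (m1 := P) (fun p => (F p ^+ 2)%:E)).
  by apply/measurable_EFinP; exact: measurable_funX.
by move=> p; rewrite lee_fin sqr_ge0.
Qed.

(** Cauchy-Schwarz against the constant 1 in each section, then Tonelli. *)
Lemma sqr_partial_Rintegral_le : (forall w, sqint mu (fun v => F (w, v))) ->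
  (\int[P]_w ((\int[mu]_v F (w, v)) ^+ 2)%:E <=
   \int[mu]_v \int[P]_w (F (w, v) ^+ 2)%:E)%E.
Proof.
move=> sF.
have mF2 : measurable_fun setT (fun p => (F p ^+ 2)%:E).
  by apply/measurable_EFinP; exact: measurable_funX.
have F2_ge0 p : (0 <= (F p ^+ 2)%:E)%E by rewrite lee_fin sqr_ge0.
rewrite -(fubini_tonelli (m1 := P) (m2 := mu) _ mF2)//.
apply: ge0_le_integral => //=.
- by move=> w _; rewrite lee_fin sqr_ge0.
- apply/measurable_EFinP; apply: measurable_funX.
  exact: measurable_partial_Rintegral.
- exact: (measurable_fun_fubini_tonelli_F (m2 := mu) (fun p => (F p ^+ 2)%:E)).
- move=> w _; have := cauchy_schwarz_ip (sF w) (sqint_cst mu 1).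
  have -> : ip mu (cst 1) (cst 1) = 1.
    rewrite /ip; under eq_Rintegral do rewrite mulr1.
    rewrite Rintegral_cst// mul1r.
    exact: (congr1 fine (probability_setT mu)).
  rewrite mulr1 -lee_fin -secmomE// /secmom unlock.
  have -> // : ip mu (fun v => F (w, v)) (cst 1) = \int[mu]_v F (w, v).
  by apply: eq_Rintegral => v _; rewrite mulr1.
Qed.

End partial_integral.

(** * Continuous Gaussian paths over the line, determined by their values on [0, 1] *)

Section gaussian_path.
Context {d} {Omega : measurableType d} {R : realType} (P : probability Omega R).
Variable x : R -> Omega -> R.
Hypothesis x_gaussian : forall n (a t : 'I_n -> R),
  centered_gaussian P (fun w => \sum_(i < n) a i * x (t i) w).
Hypothesis x_continuous : forall w, continuous (x ^~ w).
Hypothesis x_clamp : forall v, x (clamp v) = x v.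

Lemma gaussian_path2 a b u v :
  centered_gaussian P (fun w => a * x u w + b * x v w).
Proof.
have := x_gaussian (fun i : 'I_2 => if i == ord0 then a else b)
  (fun i : 'I_2 => if i == ord0 then u else v).
by congr centered_gaussian; apply/funext => w; rewrite !big_ord_recl big_ord0 addr0.
Qed.

Lemma gaussian_path1 a u : centered_gaussian P (fun w => a * x u w).
Proof.
have := gaussian_path2 a 0 u u.
by congr centered_gaussian; apply/funext => w; rewrite mul0r addr0.
Qed.

Lemma sqint_path v : sqint P (x v).
Proof.
have := gaussian_path1 1 v.
rewrite [X in centered_gaussian _ X](_ : _ = x v); last first.
  by apply/funext => w; rewrite mul1r.
by move=> gx; apply: sqintP; [case: gx|exact: centered_gaussian_secmom_lty].
Qed.

Lemma measurable_path v : measurable_fun setT (x v).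
Proof. by case: (sqint_path v). Qed.

Lemma path_bounded w : exists B, forall v, `|x v w| <= B.
Proof.
have c : {within `[0, 1], continuous (fun v => `|x v w|)}.
  apply: continuous_subspaceT => v.
  apply: (@continuous_comp _ _ _ (x ^~ w) normr); first exact: x_continuous.
  exact: norm_continuous.
have [c0 _ hc] := EVT_max ler01 c.
exists `|x c0 w| => v; rewrite -(x_clamp v); apply: hc.
by rewrite in_itv/= clamp01.
Qed.

(* Otherwise suitable [x (u n)] divided by [n.+1] would be Gaussian variables
   converging pointwise to 0 with second moments greater than 1. *)
Lemma path_norm_bounded : exists M, forall v, ip P (x v) (x v) <= M.
Proof.
apply: contrapT => /forallNP noM.
have /choice[u hu] n : exists v, n.+1%:R ^+ 2 < ip P (x v) (x v).
  have /existsNP[v] := noM (n.+1%:R ^+ 2).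
  by move=> /negP; rewrite -ltNge; exists v.
have Z0 w : n.+1%:R^-1 * x (u n) w @[n --> \oo] --> (0 : R).
  have [B hB] := path_bounded w.
  apply/cvgr0Pnorm_le => e e0.
  have B0 : 0 < `|B| + 1 by rewrite ltr_wpDl.
  have := @cvg_harmonic R; move=> /cvgr0Pnorm_le/(_ _ (divr_gt0 e0 B0)).
  apply: filterS => n; rewrite /harmonic/= ger0_norm// => ne.
  rewrite normrM ger0_norm// -[e](divfK (lt0r_neq0 B0)).
  apply: ler_pM => //; apply: (le_trans (hB _)).
  by rewrite (le_trans (ler_norm _))// lerDl.
have /fine_cvgP[_] := cvg_secmom_centered_gaussian
  (fun n => gaussian_path1 (n.+1%:R^-1) (u n)) Z0.
move=> /cvgr0Pnorm_le/(_ _ ltr01)[N _ /(_ N (leqnn _))] /=.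
rewrite secmomE/=; last exact/sqintZ/sqint_path.
have := @ip_sqrDZ _ _ _ P (N.+1%:R^-1) 0 _ _ (sqint_path (u N)) (sqint_path (u N)).
rewrite [X in ip _ X X](_ : _ = (fun w => N.+1%:R^-1 * x (u N) w)); last first.
  by apply/funext => w; rewrite mul0r addr0.
move=> ->; rewrite mulr0 !mul0r expr0n/= !mul0r !addr0.
rewrite ger0_norm ?mulr_ge0 ?sqr_ge0 ?ip_ge0//.
rewrite exprVn mulrC ler_pdivrMr ?exprn_gt0// mul1r.
by rewrite leNgt hu.
Qed.

(** Increments are centered Gaussian, so continuity of each path upgrades to mean-square
    continuity. *)
Lemma cvg_path_secmom (u : nat -> R) v : u n @[n --> \oo] --> v ->
  secmom P (fun w => x (u n) w - x v w) @[n --> \oo] --> 0%E.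
Proof.
move=> uv; apply: cvg_secmom_centered_gaussian.
  move=> n; have := gaussian_path2 1 (-1) (u n) v.
  by congr centered_gaussian; apply/funext => w; rewrite mul1r mulN1r.
move=> w; rewrite -[0](subrr (x v w)); apply: cvgB; last exact: cvg_cst.
exact: (continuous_cvg _ (@x_continuous w v) uv).
Qed.

(** Separates [v] from [w]: joint measurability and integration in [v] of the step path reduce to
    finite sums. *)
Lemma path_gridE n v w : x ((grid n v)%:R / n.+1%:R) w =
  \sum_(i < n.+2) \1_[set z : R | grid n z = i] v * x (i%:R / n.+1%:R) w.
Proof.
rewrite (bigD1 (Ordinal (grid_lt n v)))//= indicE mem_set// mul1r.
rewrite big1 ?addr0// => i /eqP iv; rewrite indicE memNset ?mul0r//=.
by move=> vi; apply: iv; apply: val_inj.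
Qed.

Lemma cvg_path_grid v w : x ((grid n v)%:R / n.+1%:R) w @[n --> \oo] --> x v w.
Proof.
rewrite -(x_clamp v).
exact: (continuous_cvg _ (@x_continuous w (clamp v)) (@cvg_grid R v)).
Qed.

Lemma measurable_path_grid n :
  measurable_fun setT (fun p : Omega * R => x ((grid n p.2)%:R / n.+1%:R) p.1).
Proof.
rewrite [X in measurable_fun _ X](_ : _ = fun p : Omega * R =>
    \sum_(i < n.+2) \1_[set z : R | grid n z = i] p.2 *
                    x (i%:R / n.+1%:R) p.1); last first.
  by apply/funext => p; rewrite path_gridE.
apply: measurable_sum => i; apply: measurable_funM.
  have m1 : measurable_fun setT (\1_[set z : R | grid n z = i] : R -> R).
    by apply: measurable_indic; exact: (@measurable_grid R n i).
  exact: (measurableT_comp m1 measurable_snd).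
exact: (measurableT_comp (measurable_path _) measurable_fst).
Qed.

(** The path is the pointwise limit of its jointly measurable step approximations. *)
Lemma measurable_path_joint :
  measurable_fun setT (fun p : Omega * R => x p.2 p.1).
Proof.
apply: (measurable_fun_cvg measurable_path_grid) => p _.
exact: cvg_path_grid.
Qed.

(** * The average of a path against a probability measure *)

Section average.
Variable mu : probability R R.

Definition path_avg w : R := \int[mu]_v x v w.

Lemma sqint_path_section w : sqint mu (x ^~ w).
Proof.
apply: sqint_bounded (path_bounded w).
exact: (measurableT_comp measurable_path_joint (pair1_measurable w)).
Qed.

Lemma sqint_path_grid_section n w :
  sqint mu (fun v => x ((grid n v)%:R / n.+1%:R) w).
Proof.
apply: sqint_bounded.
  exact: (measurableT_comp (measurable_path_grid n) (pair1_measurable w)).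
by have [B hB] := path_bounded w; exists B.
Qed.

Lemma sqint_path_avg : sqint P path_avg.
Proof.
apply: sqintP.
  exact: (measurable_partial_Rintegral mu measurable_path_joint).
rewrite /secmom unlock.
apply: (le_lt_trans (sqr_partial_Rintegral_le P measurable_path_joint
  sqint_path_section)).
have [M hM] := path_norm_bounded.
apply: (@le_lt_trans _ _ (\int[mu]_v (`|M|)%:E)%E); last first.
  by rewrite integral_cst//= probability_setT mule1 ltry.
apply: ge0_le_integral => //=.
- by move=> v _; apply: integral_ge0 => w _; rewrite lee_fin sqr_ge0.
- exact: (measurable_partial_sqr P measurable_path_joint).
- move=> v _.
  have := secmomE (sqint_path v); rewrite /secmom unlock => ->.
  by rewrite lee_fin (le_trans (hM v))// ler_norm.
Qed.

(** Licenses Fubini. Integrating in [w] first, [|x h| <= x^2 + h^2] gives a bound uniform in [v] by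
    [path_norm_bounded]. *)
Lemma integrable_path_mul h : sqint P h ->
  (P \x mu)%E.-integrable setT (fun p => (x p.2 p.1 * h p.1)%:E).
Proof.
move=> sh; have [mh _] := sh.
have mxh : measurable_fun setT (fun p : Omega * R => (x p.2 p.1 * h p.1)%:E).
  apply/measurable_EFinP; apply: measurable_funM.
    exact: measurable_path_joint.
  exact: (measurableT_comp mh measurable_fst).
apply: (integrable21ltyP P mu mxh).2.
have [M hM] := path_norm_bounded.
apply: (@le_lt_trans _ _ (\int[mu]_v (`|M| + ip P h h)%:E)%E); last first.
  by rewrite integral_cst//= probability_setT mule1 ltry.
apply: ge0_le_integral => //=.
- by move=> v _; apply: integral_ge0 => w _.
- apply: (measurable_fun_fubini_tonelli_G (m1 := P)
    (fun p => `|(x p.2 p.1 * h p.1)%:E|%E)) => //.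
  exact: measurableT_comp.
move=> v _.
have sx := sqint_path v.
apply: (@le_trans _ _ (\int[P]_w ((x v w ^+ 2)%:E + (h w ^+ 2)%:E))%E).
  apply: ge0_le_integral => //=.
  - apply/measurable_EFinP; apply: measurableT_comp => //.
    by apply: measurable_funM => //; exact: measurable_path.
  - apply: emeasurable_funD; apply/measurable_EFinP; apply: measurable_funX => //.
    exact: measurable_path.
  - move=> w _; rewrite lee_fin normrM.
    have nK (k : R) : k ^+ 2 = `|k| ^+ 2 by rewrite real_normK ?num_real.
    rewrite (nK (x v w)) (nK (h w)); move: `|x v w| `|h w| => a b.
    by have := sqr_ge0 (a - b); have := sqr_ge0 a; have := sqr_ge0 b; nra.
rewrite integralD//=; [|by case: sx|by case: sh].
have := secmomE sx; rewrite /secmom unlock => ->.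
have := secmomE sh; rewrite /secmom unlock => ->.
by rewrite -EFinD lee_fin lerD2r (le_trans (hM v))// ler_norm.
Qed.

Lemma integrable_ip_path h : sqint P h ->
  mu.-integrable setT (fun v => (ip P (x v) h)%:E).
Proof.
move=> sh; apply: sqint_int; apply: sqint_bounded.
  apply/measurable_EFinP.
  rewrite [X in measurable_fun _ X](_ : _ =
      fun v => \int[P]_w (x v w * h w)%:E)%E; last first.
    by apply/funext => v; rewrite ipE//; exact: sqint_path.
  exact: (measurable_fubini_G (integrable_path_mul sh)).
(* Cauchy-Schwarz bounds the square of the inner product by [M * ip P h h], and [a <= 1 + a^2]. *)
have [M hM] := path_norm_bounded; exists (1 + M * ip P h h) => v.
have cs := cauchy_schwarz_ip (sqint_path v) sh.
have := ler_wpM2r (ip_ge0 P h) (hM v).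
move: cs; have -> : ip P (x v) h ^+ 2 = `|ip P (x v) h| ^+ 2.
  by rewrite real_normK ?num_real.
by move: `|_| => a; have := sqr_ge0 (a - 1); nra.
Qed.

(** Fubini. Taking [h] to be [x v] or the average itself turns potentials and energies into inner
    products. *)
Lemma integral_ip_path h : sqint P h ->
  (\int[mu]_v (ip P (x v) h)%:E)%E = (ip P path_avg h)%:E.
Proof.
move=> sh; rewrite -ipE//; last exact: sqint_path_avg.
under eq_integral => v _ do rewrite -(ipE (sqint_path v) sh).
rewrite -(Fubini (integrable_path_mul sh)).
apply: eq_integral => w _ /=.
rewrite /path_avg -RintegralZr//; last first.
  exact: (sqint_int (sqint_path_section w)).
rewrite /Rintegral fineK//; apply: integrable_fin_num => //.
have := sqintZ (h w) (sqint_path_section w).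
by move=> /sqint_int; under eq_fun do rewrite mulrC.
Qed.

Lemma path_avg_approx : exists G : nat -> Omega -> R,
  (forall n, exists (k : nat) (a t : 'I_k -> R), (forall i, 0 <= t i <= 1) /\
    G n = fun w => \sum_(i < k) a i * x (t i) w) /\
  secmom P (fun w => G n w - path_avg w) @[n --> \oo] --> 0%E.
Proof.
exists (fun n w => \int[mu]_v x ((grid n v)%:R / n.+1%:R) w); split.
  move=> n.
  (* The integral of the step path is a Riemann sum weighted by the [mu]-masses of the grid cells.
     Clamping the nodes puts them in [0, 1] without changing [x]. *)
  exists n.+2, (fun i => fine (mu [set z : R | grid n z = i])),
    (fun i => clamp (i%:R / n.+1%:R)); split => [i|].
    exact: clamp01.
  apply/funext => w; under eq_Rintegral do rewrite path_gridE.
  rewrite /Rintegral; under eq_integral do rewrite -sumEFin.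
  have mG i : measurable [set z : R | grid n z = i] by exact: measurable_grid.
  rewrite integral_sum//; last first.
    move=> i; under eq_fun do rewrite EFinM muleC.
    by apply: integrableZl => //; exact: integrable_indic.
  rewrite (eq_bigr (fun i : 'I_n.+2 =>
    (fine (mu [set z : R | grid n z = i]) * x (i%:R / n.+1%:R) w)%:E)).
    by rewrite sumEFin/=; apply: eq_bigr => i _; rewrite x_clamp.
  move=> i _; under eq_integral do rewrite EFinM.
  rewrite integralZr//; last exact: integrable_indic.
  by rewrite integral_indic// setIT EFinM fineK// fin_num_measure.
pose F n (p : Omega * R) := x ((grid n p.2)%:R / n.+1%:R) p.1 - x p.2 p.1.
have mF n : measurable_fun setT (F n).
  apply: measurable_funB; first exact: measurable_path_grid.
  exact: measurable_path_joint.
have sF n w : sqint mu (fun v => F n (w, v)).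
  exact: (sqintB (sqint_path_grid_section n w) (sqint_path_section w)).
have le_int n : (secmom P (fun w =>
    (\int[mu]_v x ((grid n v)%:R / n.+1%:R) w) - path_avg w)%R <=
    \int[mu]_v \int[P]_w (F n (w, v) ^+ 2)%:E)%E.
  apply: le_trans (sqr_partial_Rintegral_le P (mF n) (sF n)).
  rewrite /secmom unlock le_eqVlt; apply/orP; left; apply/eqP.
  apply: eq_integral => w _; rewrite -RintegralB//.
  - exact: (sqint_int (sqint_path_grid_section n w)).
  - exact: (sqint_int (sqint_path_section w)).
have [M hM] := path_norm_bounded.
have sxF n v : sqint P (fun w => F n (w, v)).
  exact: (sqintB (sqint_path ((grid n v)%:R / n.+1%:R)) (sqint_path v)).
have FE n v : (\int[P]_w (F n (w, v) ^+ 2)%:E)%E =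
    (ip P (fun w => F n (w, v)) (fun w => F n (w, v)))%:E.
  by have := secmomE (sxF n v); rewrite /secmom unlock.
(* Dominated convergence in [v]: mean-square continuity gives the pointwise limit, and
   [(a - b)^2 <= 2 a^2 + 2 b^2] gives the dominating constant [4 * M]. *)
have F0 : (\int[mu]_v \int[P]_w (F n (w, v) ^+ 2)%:E)%E @[n --> \oo] --> 0%E.
  rewrite -(integral0 mu setT).
  apply: (@dominated_cvg _ _ _ mu setT _ _ _ (cst (4 * M)%:E)) => //=.
  - by move=> n; exact: (measurable_partial_sqr P (mF n)).
  - move=> v _.
    have := cvg_path_secmom (@cvg_grid R v).
    by rewrite x_clamp /secmom unlock.
  - exact: (finite_measure_integrable_cst _ (4 * M)).
  - move=> n v _; rewrite FE /= lee_fin ger0_norm ?ip_ge0//.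
    have su := sqint_path ((grid n v)%:R / n.+1%:R); have sv := sqint_path v.
    rewrite (ip_sqrB su sv).
    have := ip_ge0 P (fun w => 1 * x ((grid n v)%:R / n.+1%:R) w + 1 * x v w).
    rewrite (ip_sqrDZ _ _ su sv).
    have := hM ((grid n v)%:R / n.+1%:R); have := hM v.
    lra.
apply: (squeeze_cvge _ (cvg_cst 0%E) F0).
near=> n; rewrite le_int andbT.
by rewrite /secmom unlock; apply: integral_ge0 => w _; rewrite lee_fin sqr_ge0.
Unshelve. all: by end_near.
Qed.

End average.

End gaussian_path.

(** * The optimization problem *)

Section optimization.
Context {R : realType} {d : nat} {dO : measure_display}.
Context {Omega : measurableType dO} (P : probability Omega R).
Variables (T : set 'rV[R]_d) (X : 'rV[R]_d -> Omega -> R) (xi : R -> 'rV[R]_d).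
Hypothesis X_gaussian : centered_gaussian_field P T X.
Hypothesis X_continuous : forall w, {within T, continuous (fun t => X t w)}.
Hypothesis xi_continuous : {within `[0%R, 1%R]%classic, continuous xi}.
Hypothesis xiT : xi @` `[0%R, 1%R]%classic `<=` T.

Let x (v : R) := X (xi (clamp v)).

Let xi_clamp v : T (xi (clamp v)).
Proof. by apply: xiT; exists (clamp v) => //=; rewrite in_itv/= clamp01. Qed.

Let x_gaussian n (a t : 'I_n -> R) :
  centered_gaussian P (fun w => \sum_(i < n) a i * x (t i) w).
Proof.
exact: (X_gaussian.2 n a (fun i => xi (clamp (t i))) (fun i => xi_clamp (t i))).
Qed.

Let x_continuous w : continuous (x ^~ w).
Proof.
move=> v.
(* [h1] and [h2] land in the neighborhood filters relative to [0, 1] and [T], the ones along which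
   [xi] and the sample paths are continuous. *)
have h1 : clamp @ v --> within `[0%R, 1%R]%classic (nbhs (clamp v)).
  move=> A hA; have hc : nbhs v (clamp @^-1` _) := @continuous_clamp R v _ hA.
  apply: (@filterS _ (nbhs v) _ _ _ _ hc) => u /=; apply.
  by rewrite in_itv/= clamp01.
have h2 : xi @ within `[0%R, 1%R]%classic (nbhs (clamp v)) -->
    within T (nbhs (xi (clamp v))).
  have c01 : `[0%R, 1%R]%classic (clamp v) by rewrite /= in_itv/= clamp01.
  have /subspace_continuousP/(_ _ c01) h := xi_continuous.
  move=> A hA; have hc : within _ (nbhs (clamp v)) (xi @^-1` _) := h _ hA.
  apply: (@filterS _ (nbhs (clamp v)) _ _ _ _ hc) => u /= + u01.
  by move=> /(_ u01); apply; apply: xiT; exists u.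
have /subspace_continuousP/(_ _ (xi_clamp v)) h3 := @X_continuous w.
exact: (cvg_comp _ _ h1 (cvg_comp _ _ h2 h3)).
Qed.

Let x_clamp v : x (clamp v) = x v.
Proof. by rewrite /x clampK. Qed.

Let x01 (v : R) : `[0%R, 1%R]%classic v -> x v = X (xi v).
Proof. by rewrite /= in_itv/= => v01; rewrite /x clamp_id. Qed.

Let sx v : sqint P (x v).
Proof. exact: (sqint_path x_gaussian). Qed.

Let avg (mu : probability R R) := path_avg x mu.

Let savg mu : sqint P (avg mu).
Proof. exact: (sqint_path_avg x_gaussian x_continuous x_clamp). Qed.

(** The complement of [0, 1] is [mu]-null; this links the integrals over [0, 1] with the averages
    over the line. *)
Let integral01 (mu : probability R R) (f : R -> \bar R) : prob01 mu ->
  mu.-integrable setT f ->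
  (\int[mu]_(v in `[0%R, 1%R]%classic) f v = \int[mu]_v f v)%E.
Proof.
move=> mu1 fi.
have mC : mu (~` `[0%R, 1%R]%classic : set R) = 0%E.
  by rewrite probability_setC// mu1 subee.
rewrite [RHS](@negligible_integral _ _ _ mu setT
  (~` `[0%R, 1%R]%classic : set R))//.
- by rewrite setTD setCK.
- exact: measurableC.
Qed.

Lemma covpotE mu (v : R) : prob01 mu -> `[0%R, 1%R]%classic v ->
  covpot P X xi mu v = (ip P (avg mu) (x v))%:E.
Proof.
move=> mu1 v01.
have [h1 h2] := (integrable_ip_path x_gaussian x_continuous x_clamp mu (sx v),
  integral_ip_path x_gaussian x_continuous x_clamp mu (sx v)).
rewrite -h2 -integral01//; apply: eq_integral => u; rewrite inE => u01.
by rewrite /covX -!x01// unlock ipE.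
Qed.

Lemma energyE mu : prob01 mu -> energy P X xi mu = (ip P (avg mu) (avg mu))%:E.
Proof.
move=> mu1.
have [h1 h2] := (integrable_ip_path x_gaussian x_continuous x_clamp mu (savg mu),
  integral_ip_path x_gaussian x_continuous x_clamp mu (savg mu)).
rewrite -h2 -integral01//; apply: eq_integral => u; rewrite inE => u01.
by rewrite covpotE// ipC.
Qed.

Lemma Rintegral_avg mu w : prob01 mu ->
  \int[mu]_(v in `[0%R, 1%R]%classic) X (xi v) w = avg mu w.
Proof.
move=> mu1; rewrite /avg /path_avg /Rintegral -integral01//.
  by congr fine; apply: eq_integral => u; rewrite inE => u01; rewrite x01.
exact: (sqint_int (sqint_path_section x_gaussian x_continuous x_clamp mu w)).
Qed.

Lemma inL_sqint H : inL P T X H -> sqint P H.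
Proof. by move=> [mH [Hoo _]]; exact: sqintP. Qed.

(** The scaled Riemann sums approximate. The factor [c] is present because the optimal element is a
    multiple of the average. *)
Lemma inL_avg c mu : inL P T X (fun w => c * avg mu w).
Proof.
have sc := sqintZ c (savg mu); split; first by case: sc.
split; first by rewrite secmomE// ltry.
have [G [hG G0]] := path_avg_approx x_gaussian x_continuous x_clamp mu.
exists (fun n w => c * G n w); split => [n|].
  have [k [a [t [t01 ->]]]] := hG n.
  exists k, (fun i => c * a i), (fun i => xi (clamp (t i))); split => //.
  by apply/funext => w; rewrite mulr_sumr; apply: eq_bigr => i _; rewrite mulrA.
rewrite [X in X @ _ --> _](_ : _ = fun n =>
    ((c ^+ 2)%:E * secmom P (fun w => G n w - avg mu w)%R)%E); last first.
  apply/funext => n; rewrite /secmom unlock -ge0_integralZl//=.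
  - by apply: eq_integral => w _; rewrite -EFinM -mulrBr exprMn.
  - apply/measurable_EFinP; apply: measurable_funX; apply: measurable_funB.
      have [k [a [t [_ ->]]]] := hG n.
      by apply: measurable_sum => i; apply: measurable_funM => //; case: (sx (t i)).
    by case: (savg mu).
  - by move=> w _; rewrite lee_fin sqr_ge0.
  - by rewrite lee_fin sqr_ge0.
by rewrite -(mule0 (c ^+ 2)%:E); apply: cvgeZl.
Qed.

Lemma feasible_ip H v : feasible P T X xi H -> 1 <= ip P (x v) H.
Proof.
move=> [/inL_sqint sH hH]; rewrite -x_clamp.
have c01 : `[0%R, 1%R]%classic (clamp v) by rewrite /= in_itv/= clamp01.
have := hH _ c01.
by rewrite unlock -x01// ipE// lee_fin.
Qed.

Lemma feasible_ip_avg H mu : feasible P T X xi H -> 1 <= ip P (avg mu) H.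
Proof.
move=> fH; have sH := inL_sqint fH.1.
rewrite -lee_fin -(integral_ip_path x_gaussian x_continuous x_clamp mu sH).
have -> : (1%:E = \int[mu]_v (1%:E : \bar R))%E.
  by rewrite integral_cst//= probability_setT mule1.
apply: le_integral => //.
- exact: (finite_measure_integrable_cst _ 1).
- exact: (integrable_ip_path x_gaussian x_continuous x_clamp mu sH).
- by move=> v _; rewrite lee_fin feasible_ip.
Qed.

Lemma feasible_energy H mu : feasible P T X xi H ->
  1 <= ip P (avg mu) (avg mu) * ip P H H.
Proof.
move=> fH; have sH := inL_sqint fH.1.
apply: le_trans (cauchy_schwarz_ip (savg mu) sH).
by rewrite exprn_ege1// feasible_ip_avg.
Qed.

Lemma feasible_energy_gt0 H mu : feasible P T X xi H ->
  0 < ip P (avg mu) (avg mu).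
Proof.
move=> fH; rewrite lt_neqAle ip_ge0 andbT; apply/eqP => e0.
by have := feasible_energy mu fH; rewrite -e0 mul0r ler10.
Qed.

(* First-order condition for perturbing [mu] towards the Dirac mass at [v]. *)
Lemma inW_ip_ge mu (v : R) : inW P X xi mu -> `[0%R, 1%R]%classic v ->
  ip P (avg mu) (avg mu) <= ip P (avg mu) (x v).
Proof.
move=> [mu1 muW] v01.
set e := ip P (avg mu) (avg mu); set c := ip P (avg mu) (x v).
(* Minimality of [e] against the energy [(1-t)^2 e + 2 t (1-t) c + t^2 k] of the mixture, where
   [k = ip P (x v) (x v)], after cancelling [e] and dividing by [t]. *)
have key t : 0 < t < 1 -> (2 - t) * e <= 2 * (1 - t) * c + t * ip P (x v) (x v).
  move=> t01.
  have [m [mE mI]] := exists_mixture mu (dirac v) t01.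
  have m1 : prob01 m.
    have d1 : (\d_v (`[0%R, 1%R]%classic : set R) = 1 :> \bar R)%E.
      by rewrite diracE mem_set.
    rewrite /prob01 mE mu1 -[X in (_ + _ * X)%E]/(\d_v _) d1.
    by rewrite !mule1 -EFinD subrK.
  have avgE : avg m = fun w => (1 - t) * avg mu w + t * x v w.
    apply/funext => w; rewrite /avg /path_avg mI.
    - congr (_ + _ * _); rewrite /Rintegral integral_dirac//=.
        by rewrite indicT mul1r.
      apply/measurable_EFinP.
      by case: (sqint_path_section x_gaussian x_continuous x_clamp mu w).
    - exact: (sqint_int (sqint_path_section x_gaussian x_continuous x_clamp mu w)).
    - exact: (sqint_int
        (sqint_path_section x_gaussian x_continuous x_clamp (dirac v) w)).
  have := muW _ m1; rewrite !energyE// lee_fin avgE ip_sqrDZ// -/e -/c.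
  move=> h; case/andP: t01 => t0 t1.
  rewrite -(ler_pM2l t0).
  by nra.
rewrite leNgt; apply/negP => ce.
set k := ip P (x v) (x v) in key.
(* [key] rearranges to [2 (e - c) <= t (e - 2 c + k)]. With [t <= (e - c) / D] the right side is at
   most [e - c], contradicting [c < e]; the bound [2^-1] keeps [t < 1]. *)
pose D := `|e - 2 * c + k| + 1.
have D0 : 0 < D by rewrite ltr_wpDl.
pose t := minr 2^-1 ((e - c) / D).
have t0 : 0 < t by rewrite lt_min invr_gt0 ltr0n/= divr_gt0// subr_gt0.
have t1 : t < 1 by rewrite gt_min invf_lt1 ?ltr1n.
have tD : t * D <= e - c by rewrite -ler_pdivlMr// ge_min lexx orbT.
have := key t; rewrite t0 t1 => /(_ isT).
have : t * (e - 2 * c + k) <= t * D.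
  by rewrite ler_pM2l// (le_trans (ler_norm _))// lerDl.
by nra.
Qed.

Lemma inW_representer mu H : inW P X xi mu -> feasible P T X xi H ->
  feasible P T X xi (fun w => (ip P (avg mu) (avg mu))^-1 * avg mu w).
Proof.
move=> muW fH; have e0 := feasible_energy_gt0 mu fH.
split; first exact: inL_avg.
move=> v v01; have sc := sqintZ (ip P (avg mu) (avg mu))^-1 (savg mu).
rewrite unlock -x01// ipE// lee_fin ipC.
have := @ipDZl _ _ _ P (ip P (avg mu) (avg mu))^-1 0 _ _ _
  (savg mu) (savg mu) (sx v).
under [X in ip _ X _ = _ -> _]funext do rewrite mul0r addr0.
move=> ->; rewrite mul0r addr0 mulrC ler_pdivlMr// mul1r.
exact: inW_ip_ge.
Qed.

Lemma inW_CX mu H : inW P X xi mu -> feasible P T X xi H ->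
  CX P T X xi = ((ip P (avg mu) (avg mu))^-1)%:E.
Proof.
move=> muW fH; have e0 := feasible_energy_gt0 mu fH.
set e := ip P (avg mu) (avg mu) in e0 *.
apply/eqP; rewrite eq_le; apply/andP; split.
  apply: ereal_inf_lbound; exists (fun w => e^-1 * avg mu w).
    exact: (inW_representer muW fH).
  have sc := sqintZ e^-1 (savg mu); rewrite secmomE//.
  have := @ip_sqrDZ _ _ _ P e^-1 0 _ _ (savg mu) (savg mu).
  rewrite [X in ip _ X X](_ : _ = (fun w => e^-1 * avg mu w)); last first.
    by apply/funext => w; rewrite mul0r addr0.
  by move=> ->; congr EFin; rewrite -/e; field; rewrite gt_eqF.
apply: le_ereal_inf_tmp => _ [K fK <-].
rewrite secmomE; last exact: inL_sqint fK.1.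
by rewrite lee_fin -[_^-1]mul1r ler_pdivrMr// mulrC feasible_energy.
Qed.

Lemma minimizer_ae mu H : inW P X xi mu -> feasible P T X xi H ->
  secmom P H = CX P T X xi ->
  {ae P, forall w, H w = fine (CX P T X xi) * avg mu w}.
Proof.
move=> muW fH HC; have e0 := feasible_energy_gt0 mu fH.
have sH := inL_sqint fH.1; move: HC; rewrite (inW_CX muW fH) /= secmomE//.
set e := ip P (avg mu) (avg mu) in e0 *; move=> [HH].
have sD := sqintDZ 1 (- e^-1) sH (savg mu).
have D0 : ip P (fun w => 1 * H w + - e^-1 * avg mu w)
               (fun w => 1 * H w + - e^-1 * avg mu w) = 0.
  apply/eqP; rewrite eq_le ip_ge0 andbT ip_sqrDZ// HH -/e.
  have := feasible_ip_avg mu fH; rewrite ipC => Hm.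
  (* Optimality makes the squared norm of [H] equal to [e^-1], so the squared distance collapses to
     a positive multiple of [1 - ip P H (avg mu)], which feasibility makes nonpositive. *)
  have -> : 1 ^+ 2 * e^-1 + 2 * 1 * - e^-1 * ip P H (avg mu) + (- e^-1) ^+ 2 * e =
    2 * e^-1 * (1 - ip P H (avg mu)) by field; rewrite gt_eqF.
  apply: mulr_ge0_le0; last by rewrite subr_le0.
  by rewrite mulr_ge0// invr_ge0 ltW.
apply: filterS (ip_eq0_ae sD D0) => w.
by rewrite mul1r mulNr => /eqP; rewrite subr_eq0 => /eqP.
Qed.

(** The potential minus the energy is nonnegative with [mu]-integral 0, hence zero almost
    everywhere. Were it zero nowhere, the exceptional null set would be the whole line, which has
    mass 1. *)
Lemma inW_ip_eq mu : inW P X xi mu ->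
  exists2 v, `[0%R, 1%R]%classic v & ip P (avg mu) (x v) = ip P (avg mu) (avg mu).
Proof.
move=> muW; set e := ip P (avg mu) (avg mu); apply: contrapT => noeq.
have c01 v : `[0%R, 1%R]%classic (clamp v) by rewrite /= in_itv/= clamp01.
have neq v : ip P (x v) (avg mu) - e != 0.
  apply/eqP => /eqP; rewrite subr_eq0 => /eqP ve; apply: noeq.
  by exists (clamp v) => //; rewrite x_clamp ipC.
have ge v : 0 <= ip P (x v) (avg mu) - e.
  by rewrite subr_ge0 ipC -x_clamp; exact: inW_ip_ge.
have ix := integrable_ip_path x_gaussian x_continuous x_clamp mu (savg mu).
have ie : mu.-integrable setT (cst e%:E).
  exact: (finite_measure_integrable_cst _ e).
have mf : measurable_fun setT (fun v => (ip P (x v) (avg mu) - e)%:E).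
  exact: (measurable_int mu (integrableB measurableT ix ie)).
have int0 : (\int[mu]_v `|(ip P (x v) (avg mu) - e)%:E| = 0)%E.
  under eq_integral do rewrite gee0_abs ?lee_fin//.
  under eq_integral do rewrite EFinB.
  rewrite integralB//.
  rewrite (integral_ip_path x_gaussian x_continuous x_clamp mu (savg mu)).
  by rewrite integral_cst//= probability_setT mule1 -EFinB subrr.
have /(ae_eq_integral_abs mu measurableT mf)[N [mN N0 sN]] := int0.
have NT : N = setT.
  by apply/seteqP; split => // v _; apply: sN => /(_ I)[] /eqP; exact/negP.
by have := probability_setT mu; rewrite -NT N0 => /eqP; rewrite eq_sym onee_eq0.
Qed.

Lemma inW_of_ip_ge mu : prob01 mu ->
  (forall v, `[0%R, 1%R]%classic v ->
    ip P (avg mu) (avg mu) <= ip P (avg mu) (x v)) ->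
  inW P X xi mu.
Proof.
move=> mu1 muge; split => // nu nu1; rewrite !energyE// lee_fin.
have munu : ip P (avg mu) (avg mu) <= ip P (avg nu) (avg mu).
  rewrite -lee_fin -(integral_ip_path x_gaussian x_continuous x_clamp nu (savg mu)).
  have -> : ((ip P (avg mu) (avg mu))%:E =
      \int[nu]_v ((ip P (avg mu) (avg mu))%:E : \bar R))%E.
    by rewrite integral_cst//= probability_setT mule1.
  apply: le_integral => //.
  - exact: (finite_measure_integrable_cst _ (ip P (avg mu) (avg mu))).
  - exact: (integrable_ip_path x_gaussian x_continuous x_clamp nu (savg mu)).
  - move=> v _; rewrite lee_fin [leRHS]ipC -x_clamp; apply: muge.
    by rewrite /= in_itv/= clamp01.
have := ip_ge0 P (fun w => avg nu w - avg mu w).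
by rewrite (ip_sqrB (savg nu) (savg mu)); lra.
Qed.

End optimization.

Unset Implicit Arguments.

(** The minimum in (ii) is rendered as a lower bound together with a point attaining it, and [H_xi]
    as any feasible variable whose second moment is [CX]. *)
Theorem theorem4p3 (R : realType) (d : nat) (dO : measure_display)
  (Omega : measurableType dO) (P : probability Omega R)
  (T : set 'rV[R]_d) (X : 'rV[R]_d -> Omega -> R) (xi : R -> 'rV[R]_d) :
  compact T ->
  centered_gaussian_field P T X ->
  (forall w, {within T, continuous (fun t => X t w)}) ->
  {within `[0%R, 1%R]%classic, continuous xi} ->
  xi @` `[0%R, 1%R]%classic `<=` T ->
  (exists H, feasible P T X xi H) ->
  (* (i) *)
  (forall Hxi : Omega -> R,
     feasible P T X xi Hxi -> secmom P Hxi = CX P T X xi ->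
     forall mu : probability R R, inW P X xi mu ->
       {ae P, forall w,
          Hxi w = fine (CX P T X xi) * Rintegral mu `[0%R, 1%R]%classic (fun v => X (xi v) w)}) /\
  (* (ii) *)
  (forall mu : probability R R, prob01 mu ->
     (inW P X xi mu <->
      ((forall v, `[0%R, 1%R]%classic v -> (energy P X xi mu <= covpot P X xi mu v)%E) /\
       (exists2 v, `[0%R, 1%R]%classic v & covpot P X xi mu v = energy P X xi mu) /\
       (0 < energy P X xi mu)%E))).
Proof.
move=> _ Xg Xc xic xiT [H0 fH0]; split=> [H fH HC mu muW|mu mu1].
  apply: filterS (minimizer_ae Xg Xc xic xiT muW fH HC) => w.
  by rewrite -(Rintegral_avg Xg Xc xic xiT _ muW.1).
have eE := energyE Xg Xc xic xiT mu1; have cE := covpotE Xg Xc xic xiT mu1.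
rewrite eE; split=> [muW|[muge _]].
  split=> [v v01|]; first by rewrite cE// lee_fin (inW_ip_ge Xg Xc xic xiT muW).
  split; last by rewrite lte_fin (feasible_energy_gt0 Xg Xc xic xiT _ fH0).
  have [v v01 ve] := inW_ip_eq Xg Xc xic xiT muW.
  by exists v => //; rewrite cE// ve.
apply: (inW_of_ip_ge Xg Xc xic xiT mu1) => v v01.
by rewrite -lee_fin -cE//; exact: muge.
Qed.
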